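(* For token swapping on a broom, the following algorithm outputs a sorting swap sequence with the minimum number of swaps. Step 1: while some path token is not home, let $p_{\max}$ be the largest path token not home; if $p_{\max}$ is on a star leaf and has a centered star chain $t_1,\dots,t_m,p_{\max}$, perform the $m$ swaps that move $t_1,\dots,t_m$ home in this order (the last of which moves $p_{\max}$ to the center vertex); then move $p_{\max}$ home along the unique tree path. Step 2: once all path tokens are home, sort the remaining tokens on the star $v_1,\dots,v_{k+1}$ using a minimum number of swaps.
   Context: A broom consists of star leaves $v_1,\dots,v_k$, each adjacent to the center vertex $v_{k+1}$, and a path $v_{k+1},v_{k+2},\dots,v_n$. Tokens $1,\dots,n$ are placed one per vertex; a swap exchanges the tokens on the endpoints of an edge; the goal is to get token $i$ to $v_i$ for all $i$ (a token is home if it is on its destination). Tokens $1,\dots,k$ are star tokens and $k+1,\dots,n$ are path tokens. A centered star chain of a token $t_{m+1}$ is a sequence of tokens $t_1,\dots,t_{m+1}$ such that $t_1$ is currently on the center vertex $v_{k+1}$, $t_2,\dots,t_{m+1}$ are currently on star leaves, and for $1\le i\le m$ the destination vertex of $t_i$ currently contains $t_{i+1}$. *)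

(* Defs.v *)
From mathcomp Require Import all_boot all_fingroup.

Set Implicit Arguments.
Unset Strict Implicit.
Unset Printing Implicit Defensive.

(* Vertices and tokens are both indexed from 0 by 'I_n, and the destination of
   token t is the vertex t.  A broom is given by k : 'I_n, which is both the
   number of star leaves and the index of the center: the leaves are the v < k,
   the path runs through k, k+1, ..., n-1. *)
Section Broom.
Variables (n : nat) (k : 'I_n).

Definition star_edge : rel 'I_n :=
  fun u v => ((u < k) && (v == k)) || ((v < k) && (u == k)).

Definition path_edge : rel 'I_n :=
  fun u v => ((k <= u) && (v == u.+1 :> nat)) || ((k <= v) && (u == v.+1 :> nat)).

Definition broom_edge : rel 'I_n := fun u v => star_edge u v || path_edge u v.

(* c v is the token lying on vertex v. *)
Definition config := {perm 'I_n}.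

Definition position (c : config) (t : 'I_n) : 'I_n := (c^-1)%g t.

Definition home (c : config) (t : 'I_n) : bool := position c t == t.

(* (tperm u v * c)%g w = c (tperm u v w). *)
Definition swap (c : config) (e : 'I_n * 'I_n) : config :=
  (tperm e.1 e.2 * c)%g.

Definition run (c : config) (s : seq ('I_n * 'I_n)) : config := foldl swap c s.

Definition sorting (edge : rel 'I_n) (c : config) (s : seq ('I_n * 'I_n)) : Prop :=
  all (fun e => edge e.1 e.2) s /\ (forall t, home (run c s) t).

Definition min_sorting (edge : rel 'I_n) (c : config) (s : seq ('I_n * 'I_n)) : Prop :=
  sorting edge c s /\ (forall s', sorting edge c s' -> size s <= size s').

Definition path_token (t : 'I_n) : bool := k <= t.

Definition on_leaf (c : config) (t : 'I_n) : bool := position c t < k.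

(* ts = t_1, ..., t_{m+1}; the token on the destination vertex of t is c t. *)
Definition centered_star_chain (c : config) (ts : seq 'I_n) : bool :=
  if ts is t1 :: ts' then
    [&& position c t1 == k, all (on_leaf c) ts' &
        path (fun t t' => c t == t') t1 ts']
  else false.

Definition is_pmax (c : config) (p : 'I_n) : Prop :=
  [/\ path_token p, ~~ home c p &
      forall q, path_token q -> ~~ home c q -> q <= p].

(* x :: w is the simple path from x to y in the tree. *)
Definition tree_path (x y : 'I_n) (w : seq 'I_n) : bool :=
  [&& path broom_edge x w, last x w == y & uniq (x :: w)].

(* The swaps that take token t along its tree path to its destination. *)
Definition moves_home (c : config) (t : 'I_n) (s : seq ('I_n * 'I_n)) : Prop :=
  exists2 w, tree_path (position c t) t w & s = pairmap pair (position c t) w.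

(* One iteration of the while loop of Step 1, with the swaps it performs.  When
   t_i has to go home it is on the center, so its swap is on the edge (k, t_i). *)
Inductive step1_round (c : config) : seq ('I_n * 'I_n) -> Prop :=
| RoundChain p ts s :
    is_pmax c p -> on_leaf c p -> centered_star_chain c (rcons ts p) ->
    moves_home (run c [seq (k, t) | t <- ts]) p s ->
    step1_round c ([seq (k, t) | t <- ts] ++ s)
| RoundDirect p s :
    is_pmax c p ->
    ~ (on_leaf c p /\ exists ts, centered_star_chain c (rcons ts p)) ->
    moves_home c p s ->
    step1_round c s.

Definition step1_next (c' c : config) : Prop :=
  exists2 s, step1_round c s & c' = run c s.

(* Step 2 makes the algorithm nondeterministic: any shortest sorting sequence
   on the star may be chosen. *)
Inductive algorithm_output (c : config) : seq ('I_n * 'I_n) -> Prop :=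
| Step1 s s' :
    step1_round c s -> algorithm_output (run c s) s' ->
    algorithm_output c (s ++ s')
| Step2 s :
    (forall q, path_token q -> home c q) -> min_sorting star_edge c s ->
    algorithm_output c s.

End Broom.

(* Main.v *)
Require Import Defs.
From Stdlib Require Import Classical.
From mathcomp Require Import all_boot all_fingroup zify.

Set Implicit Arguments.
Unset Strict Implicit.
Unset Printing Implicit Defensive.

(** The distance of a configuration [c] is [D c + 2 L c].  Here [L c] is the
    number of nontrivial cycles of the permutation [c] contained in the leaves,
    and [D c] is the cost of sorting when swaps between two leaves are allowed
    too: bring the tokens beyond the center home directly, largest first, and
    then pay the transposition distance on the clique made of the leaves and
    the center.

    [D] changes by at most 1 under each swap of the relaxed graph, and goes up
    by exactly 1 when a swap joins a set of leaves closed under [c] to a leaf or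
    center outside it.  So a star swap that creates a leaf cycle, which raises
    [2 L] by 2, lowers [D] by 1.  Hence [D + 2 L] changes by at most 1 under
    each broom swap and is a lower bound.  Conversely each swap of the algorithm
    lowers it by 1: a chain swap brings a star token home from the center, and
    moving [pmax] from a leaf to the center creates a leaf cycle only if [pmax]
    has a centered star chain. *)

Section BroomDistance.
Variables (N : nat) (k : 'I_N.+1).
Local Notation V := 'I_N.+1.
Implicit Types (c : config N.+1) (m p u v w x y z : V).

(** * Slides and how they commute with swaps *)

Lemma tperm_val x y v :
  (tperm x y v : nat) =
  if v == x :> nat then y : nat else if v == y :> nat then x : nat else v.
Proof. by rewrite permE /= -!val_eqE /=; do 2![case: eqP => // _]. Qed.

(* [slide m x * c] is [c] after the token on [x] has gone to [m] along the tree
   path; it is the identity unless [k < m] and [x <= m]. *)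
Definition slide_fun m x v : V :=
  if ~~ ((k < m) && (x <= m)) then v else
  if v == m then x else
  if v < k then (if v == x then k else v) else
  if (x <= v) && (v < m) then inord v.+1 else v.

Lemma slide_fun_val m x v : k < m -> x <= m ->
  (slide_fun m x v : nat) =
  if v == m :> nat then x : nat else
  if v < k then (if v == x :> nat then k : nat else v : nat) else
  if (x <= v) && (v < m) then v.+1 else v.
Proof.
move=> km xm; rewrite /slide_fun km xm /= -!val_eqE /=.
do ![case: ifP => //=] => /andP[_ vm] _ _.
by rewrite inordK //; have := ltn_ord m; lia.
Qed.

Lemma slide_inj m x : injective (slide_fun m x).
Proof.
move=> v w.
have [/andP[km xm]|/negbTE H] := boolP ((k < m) && (x <= m)); last first.
  by rewrite /slide_fun H.
move=> /(congr1 val) /=; rewrite !slide_fun_val // => E; apply: val_inj => /=.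
by move: E; do ![case: ifP => /=]; lia.
Qed.

Definition slide m x : {perm V} := perm (@slide_inj m x).

Lemma slide_val m x v : k < m -> x <= m ->
  (slide m x v : nat) =
  if v == m :> nat then x : nat else
  if v < k then (if v == x :> nat then k : nat else v : nat) else
  if (x <= v) && (v < m) then v.+1 else v.
Proof. by rewrite permE; apply: slide_fun_val. Qed.

(** For [k < m] and [x <= m] this is the length of the tree path from [x] to [m]. *)
Definition travel m x : nat := if x < k then (m - k).+1 else m - x.

(** Leaf-to-leaf edges make the graph stable under slides: when a slide empties the leaf [x], the
    token on the center moves to [x], so an edge from a leaf to the center becomes one from that
    leaf to [x]. *)
Definition clique_path_edge u v : bool :=
  (u != v) && [|| (u <= k) && (v <= k), v == u.+1 :> nat | u == v.+1 :> nat].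

Lemma clique_path_edge_sym : symmetric clique_path_edge.
Proof. by move=> u v; rewrite /clique_path_edge -!val_eqE /=; lia. Qed.

(** Here [v] is the vertex after [u] on the way to [m]: either [u] is a leaf and [v] the center, or
    [v] is [u + 1]. So the slide from [u] begins with this swap. *)
Lemma slide_tperm_adjacent m u v : k < m -> u < v -> v <= m -> k <= v ->
  clique_path_edge u v -> (slide m v * tperm u v)%g = slide m u.
Proof.
move=> km uv vm kv e; apply/permP => w; apply: val_inj.
rewrite permM /= tperm_val !slide_val //; last lia.
by move: e; rewrite /clique_path_edge -!val_eqE /=; do ![case: ifP => /=]; lia.
Qed.

(** Leaves are interchangeable: conjugation by the transposition of two leaves turns the slide from
    one into the slide from the other. *)
Lemma slide_tperm_leaves m u v : k < m -> u < k -> v < k ->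
  (slide m v * tperm u v)%g = (tperm u v * slide m u)%g.
Proof.
move=> km uk vk; apply/permP => w; apply: val_inj.
rewrite !permM /= tperm_val !slide_val ?tperm_val; try lia.
by do ![case: ifP => /=]; lia.
Qed.

(** Conjugating by the slide moves the swap to the preimages of its ends. The last clause records
    where these lie when [u] is a leaf or [v] is at most the center, so that a closed set of leaves
    can be followed through the slide. *)
Lemma slide_tperm_edge m x u v : k < m -> x <= m -> u <= m -> v <= m ->
    u != x -> v != x -> clique_path_edge u v ->
  exists u' v', [/\ u' < m, v' < m, clique_path_edge u' v',
    (slide m x * tperm u v)%g = (tperm u' v' * slide m x)%g &
    (u < k -> u' = u) /\ (v <= k -> v' = if (v == k) && (x < k) then x else v)].
Proof.
move=> km xm um vm ux vx e.
(* [back w] is where the slide puts the token of [w], one step closer to the vacated [x]. *)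
pose back w : V := if w < k then w else if w == k then (if x < k then x else k)
  else if x < w then inord w.-1 else w.
have back_val w : (back w : nat) = if w < k then w : nat
    else if w == k :> nat then (if x < k then x : nat else k)
    else if x < w then w.-1 else w.
  rewrite /back -!val_eqE /=; do ![case: ifP => //=] => *.
  by rewrite inordK //; have := ltn_ord w; lia.
have slideK w : w <= m -> w != x -> slide m x (back w) = w.
  rewrite -val_eqE /= => wm wx; apply: val_inj => /=.
  by rewrite slide_val // back_val; do ![case: ifP => //=]; lia.
exists (back u), (back v); split.
- by move: ux; rewrite -val_eqE back_val /=; do ![case: ifP => //=]; lia.
- by move: vx; rewrite -val_eqE back_val /=; do ![case: ifP => //=]; lia.
- move: e ux vx; rewrite /clique_path_edge -!val_eqE /= !back_val.
  by do ![case: ifP => //=]; lia.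
- by rewrite [RHS]conjgC tpermJ !slideK.
split=> [uk|vk].
  by rewrite /back uk.
by rewrite /back; case: ltnP => //= [vk'|kv];
  [have /negbTE-> : v != k by rewrite -val_eqE /=; lia
  |have -> : v = k by (apply: val_inj => /=; lia)]; rewrite ?eqxx //.
Qed.

(** * The relaxed distance under swaps *)

(* The relaxed distance of a configuration whose tokens [j], [j + 1], ... are home. *)
Fixpoint relaxed_dist (j : nat) c : nat :=
  if j is i.+1 then
    if i <= k then N.+1 - #|porbits c|
    else travel (inord i) (position c (inord i)) +
         relaxed_dist i (slide (inord i) (position c (inord i)) * c)%g
  else N.+1 - #|porbits c|.

Definition home_from (j : nat) c : Prop := forall w, j <= w -> c w = w.

Lemma relaxed_dist_clique j c : j <= k.+1 -> relaxed_dist j c = N.+1 - #|porbits c|.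
Proof. by case: j => //= i; rewrite ltnS => ->. Qed.

Lemma relaxed_distS m c x : k < m -> c x = m ->
  relaxed_dist m.+1 c = travel m x + relaxed_dist m (slide m x * c)%g.
Proof.
move=> km Ex; rewrite /= leqNgt km /= inord_val.
by have -> : position c m = x by rewrite -Ex /position permK.
Qed.

Lemma position_le m c x : home_from m.+1 c -> c x = m -> x <= m.
Proof.
move=> H E; rewrite leqNgt; apply/negP => mx.
by move: (H x mx); rewrite E => F; rewrite F ltnn in mx.
Qed.

Lemma home_from_slide m c x :
  k < m -> home_from m.+1 c -> c x = m -> home_from m (slide m x * c)%g.
Proof.
move=> km H E w mw; have xm := position_le H E.
rewrite permM; have [wm|wm] := eqVneq w m.
  have -> : slide m x w = x by apply: val_inj; rewrite /= slide_val // wm eqxx.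
  by rewrite E.
move: wm; rewrite -val_eqE /= => wm.
have -> : slide m x w = w.
  by apply: val_inj; rewrite /= slide_val //; do ![case: ifP => /=]; lia.
by apply: H; lia.
Qed.

Lemma card_porbits_le c : #|porbits c| <= N.+1.
Proof.
by rewrite -[X in _ <= X]card_ord; apply: leq_imset_card.
Qed.

(** Points minus cycles is the transposition length, and a transposition splits or merges a single
    pair of cycles. *)
Lemma codim_porbits_tperm c u v : u != v ->
  N.+1 - #|porbits (tperm u v * c)%g| <= (N.+1 - #|porbits c|).+1.
Proof.
move=> uv; have /= := porbits_mul_tperm c u v; rewrite uv.
have := card_porbits_le c; set a := #|porbits c|; set b := #|porbits (_ * c)%g|.
by case: (u \notin _); lia.
Qed.

(** Induction on the largest token [m]. If the swap misses [m], it passes through the slide as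
    another edge below [m]. If it moves [m] between leaves, it commutes with the slides and the
    travel is unchanged. Otherwise both slides lead to the same configuration and the travel changes
    by 1. *)
Lemma relaxed_dist_tperm_le j c u v : j <= N.+1 -> home_from j c ->
    u < j -> v < j -> clique_path_edge u v ->
  relaxed_dist j (tperm u v * c)%g <= (relaxed_dist j c).+1.
Proof.
elim: j c u v => [|i IH] c u v jN H uj vj e.
  by apply: codim_porbits_tperm; case/andP: e.
have [ik|ki] := leqP i.+1 k.+1.
  by rewrite !relaxed_dist_clique //; apply: codim_porbits_tperm; case/andP: e.
have [m mE] : exists m : V, i = m by exists (Ordinal jN).
subst i; pose x := position c m; have Ex : c x = m by rewrite /x /position permKV.
have xm := position_le H Ex.
have um : u <= m by lia.
have vm : v <= m by lia.
have km : k < m by lia.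
have moved y z : y <= m -> z <= m -> clique_path_edge y z -> y = x ->
    relaxed_dist m.+1 (tperm y z * c)%g <= (relaxed_dist m.+1 c).+1.
  move=> ym zm e0 yx; subst y; have eyz := e0.
  rewrite /clique_path_edge -val_eqE /= in eyz.
  rewrite (relaxed_distS km Ex) (@relaxed_distS _ _ z) // ?permM ?tpermR // mulgA.
  have [/andP[xk zk]|] := boolP ((x < k) && (z < k)).
    rewrite slide_tperm_leaves // -mulgA /travel xk zk.
    rewrite -addnS leq_add2l IH //; try lia.
    exact: home_from_slide.
  move=> ll; suff -> : (slide m z * tperm x z)%g = slide m x.
    by rewrite -addSn leq_add2r /travel; do ![case: ifP => /=]; lia.
  have [xz|zx] := ltnP x z.
    by apply: slide_tperm_adjacent; rewrite // ?/clique_path_edge -?val_eqE /=; lia.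
  rewrite -(@slide_tperm_adjacent m z x) ?/clique_path_edge -?val_eqE /=; try lia.
  by rewrite -mulgA tpermC tperm2 mulg1.
have [ux|ux] := eqVneq u x; first exact: moved.
have [vx|vx] := eqVneq v x.
  by rewrite tpermC moved // clique_path_edge_sym.
have [u' [v' [u'm v'm e' E _]]] := slide_tperm_edge km xm um vm ux vx e.
rewrite (relaxed_distS km Ex) (@relaxed_distS _ _ x) // ?permM ?tpermD // 1?eq_sym //.
rewrite mulgA E -mulgA -addnS leq_add2l IH //; try lia.
exact: home_from_slide.
Qed.

(** On the clique, [u] and [v] lie in different cycles because [C] is closed, so the swap merges
    them. This survives each slide: the vertex [x] holding [m] is outside [C], so the slide fixes
    [C] pointwise, and a center [v] is at worst replaced by the leaf [x], again outside [C]. *)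
Lemma relaxed_dist_merge j c (C : {set V}) u v : j <= N.+1 -> home_from j c ->
    {in C, forall w, w < k /\ c w \in C} -> u \in C -> v \notin C -> v <= k ->
  relaxed_dist j (tperm u v * c)%g = (relaxed_dist j c).+1.
Proof.
have base c' v' : {in C, forall w, w < k /\ c' w \in C} -> u \in C -> v' \notin C ->
    N.+1 - #|porbits (tperm u v' * c')%g| = (N.+1 - #|porbits c'|).+1.
  move=> HC uC vC; have /= := porbits_mul_tperm c' u v'.
  have -> : u \notin porbit c' v'.
    apply: contra vC; rewrite porbit_sym => /porbitP[i ->]; rewrite permX.
    by elim: i => //= i /HC[].
  have -> : u != v' by apply: contraNneq vC => <-.
  have := card_porbits_le c'.
  by set a := #|porbits c'|; set b := #|porbits (_ * c')%g|; lia.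
elim: j c v => [|i IH] c v jN H HC uC vC vk; first exact: base.
have [ik|ki] := leqP i.+1 k.+1; first by rewrite !relaxed_dist_clique // base.
have [m mE] : exists m : V, i = m by exists (Ordinal jN).
subst i; pose x := position c m; have Ex : c x = m by rewrite /x /position permKV.
have xm := position_le H Ex.
have uk := (HC u uC).1.
have km : k < m by lia.
have xC : x \notin C.
  by apply/negP => /HC[_]; rewrite Ex => /HC[]; lia.
have ux : u != x by apply: contraNneq xC => <-.
have HC' : {in C, forall w, w < k /\ (slide m x * c)%g w \in C}.
  move=> w wC; have [wk cw] := HC w wC; split=> //; rewrite permM.
  suff -> : slide m x w = w by [].
  have : w != x by apply: contraNneq xC => <-.
  rewrite -val_eqE /= => wx; apply: val_inj; rewrite /= slide_val //.
  by do ![case: ifP => /=]; lia.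
have Hs := home_from_slide km H Ex.
have [vx|vx] := eqVneq v x.
  subst v; rewrite (relaxed_distS km Ex) (@relaxed_distS _ _ u) // ?permM ?tpermL // mulgA.
  have [xk|kx] := ltnP x k.
    rewrite tpermC slide_tperm_leaves // tpermC -mulgA IH //; last exact: ltnW.
    by rewrite /travel xk uk addnS.
  rewrite tpermC -(@slide_tperm_adjacent m u x) // ?/clique_path_edge -?val_eqE /=; try lia.
  rewrite -!mulgA (tpermC x) [X in (_ * X)%g]mulgA tperm2 mul1g /travel uk.
  by rewrite ltnNge kx /=; set z := relaxed_dist _ _; lia.
have e : clique_path_edge u v.
  have : u != v by apply: contraNneq vC => <-.
  by rewrite /clique_path_edge -val_eqE /=; lia.
have um : u <= m by lia.
have vm : v <= m by lia.
have [u' [v' [_ _ _ E [Eu Ev]]]] := slide_tperm_edge km xm um vm ux vx e.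
rewrite (relaxed_distS km Ex) (@relaxed_distS _ _ x) // ?permM ?tpermD // 1?eq_sym //.
rewrite mulgA E -mulgA (Eu uk) (Ev vk) IH ?addnS //; first exact: ltnW.
  by case: ifP.
by case: ifP => // /andP[_]; apply: ltnW.
Qed.

Lemma slide_self m : k < m -> slide m m = 1%g.
Proof.
move=> km; apply/permP => w; apply: val_inj; rewrite perm1 /= slide_val //.
by do ![case: ifP => /=]; lia.
Qed.

Lemma relaxed_dist_home j c : j <= N.+1 -> home_from j c ->
  relaxed_dist N.+1 c = relaxed_dist j c.
Proof.
move=> jN H; rewrite -(subnKC jN).
have: j + (N.+1 - j) <= N.+1 by lia.
elim: (N.+1 - j) => [|d IH] dN; first by rewrite addn0.
rewrite -IH; last lia.
rewrite addnS in dN *; have [djk|kdj] := leqP (j + d) k.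
  by rewrite !relaxed_dist_clique; lia.
pose m : V := Ordinal dN; have cm : c m = m by apply: H; rewrite /=; lia.
have km : k < m := kdj.
rewrite -[(j + d).+1]/(m.+1) (relaxed_distS km cm) slide_self // mul1g /travel ltnNge.
by rewrite (ltnW kdj) /= subnn.
Qed.

(** Beyond the center, one unit of travel is saved and the slides agree. For [m = k], the vertices
    [u] and [k] share a cycle, which the swap splits. *)
Lemma relaxed_dist_approach m c u v : k <= m -> home_from m.+1 c -> c u = m -> u < v ->
    k <= v -> v <= m -> clique_path_edge u v ->
  relaxed_dist m.+1 c = (relaxed_dist m.+1 (tperm u v * c)%g).+1.
Proof.
move=> km H Eu uv kv vm e.
have [mk|km'] := leqP m k.
  have mE : m = k by apply: val_inj => /=; lia.
  have vE : v = k by apply: val_inj => /=; lia.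
  rewrite mE in Eu; rewrite vE mE !relaxed_dist_clique //.
  have /= := porbits_mul_tperm c u k.
  have -> : u \in porbit c k by rewrite porbit_sym -Eu -[c u]/((c ^+ 1)%g u) mem_porbit.
  have -> : u != k by rewrite -vE -val_eqE /=; lia.
  have := card_porbits_le (tperm u k * c)%g.
  by set a := #|porbits c|; set b := #|porbits (_ * c)%g|; lia.
rewrite (relaxed_distS km' Eu) (@relaxed_distS _ _ v) // ?permM ?tpermR // mulgA.
rewrite slide_tperm_adjacent // /travel; move: e; rewrite /clique_path_edge -val_eqE /=.
by set z := relaxed_dist _ _; do ![case: ifP => /=]; lia.
Qed.

(** * Leaf cycles under swaps *)

Lemma eq_porbit_on c1 c2 y :
  {in porbit c1 y, c1 =1 c2} -> porbit c2 y = porbit c1 y.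
Proof.
move=> H; have E i : (c2 ^+ i)%g y = (c1 ^+ i)%g y.
  rewrite !permX; elim: i => //= i ->; rewrite H // -permX; exact: mem_porbit.
by apply/setP => z; apply/porbitP/porbitP => -[i ->]; exists i.
Qed.

Definition leaves : {set V} := [set w : V | w < k].

Definition leaf_cycle (A : {set V}) : bool := (A \subset leaves) && (1 < #|A|).

Definition leaf_cycles c : {set {set V}} := [set A in porbits c | leaf_cycle A].

Lemma mem_leaf_cycles c A w :
  A \in leaf_cycles c -> w \in A -> A = porbit c w /\ leaf_cycle A.
Proof.
rewrite inE => /andP[/imsetP[y _ ->] lA] wA; split=> //.
by apply/eqP; rewrite eq_sym eq_porbit_mem.
Qed.

Lemma leaf_cycles_porbit c w : (porbit c w \in leaf_cycles c) = leaf_cycle (porbit c w).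
Proof. by rewrite inE imset_f. Qed.

Lemma leaf_cycle_lt c w : leaf_cycle (porbit c w) -> w < k.
Proof. by case/andP => /subsetP/(_ w (porbit_id _ _)); rewrite inE. Qed.

(** Neither [u] nor the non-leaf [v] lies in [A], so the swap leaves the tokens on [A] alone. *)
Lemma leaf_cycles_tperm c u v A : k <= v -> A \in leaf_cycles (tperm u v * c)%g ->
  u \notin A -> A \in leaf_cycles c.
Proof.
move=> kv AL uA; have := AL; rewrite inE => /andP[/imsetP[y _ EA] lA].
suff EA' : porbit c y = A by rewrite -EA' leaf_cycles_porbit EA'.
rewrite EA; apply: eq_porbit_on => w; rewrite -EA => wA.
rewrite permM tpermD //; first by apply: contraNneq uA => ->.
have /andP[/subsetP/(_ w wA)] := lA; rewrite inE => wk _.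
by rewrite -val_eqE /=; lia.
Qed.

Lemma leaf_cycles_path_swap c u v : k <= u -> k <= v ->
  #|leaf_cycles (tperm u v * c)%g| <= #|leaf_cycles c|.
Proof.
move=> ku kv; apply/subset_leq_card/subsetP => A AL.
apply: (leaf_cycles_tperm kv AL); apply/negP => uA.
have := mem_leaf_cycles AL uA => -[EA]; rewrite EA => /leaf_cycle_lt; lia.
Qed.

(** Every leaf cycle of the new configuration other than the one through [x] avoids both ends of the
    swap, hence was there before. *)
Lemma leaf_cycles_star_swap c x :
  #|leaf_cycles (tperm x k * c)%g| <=
  leaf_cycle (porbit (tperm x k * c)%g x) + #|leaf_cycles c|.
Proof.
set c' := (_ * c)%g.
rewrite -(cardsID [set porbit c' x]); apply: leq_add.
  have [lx|nlx] := boolP (leaf_cycle _).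
    by rewrite (leq_trans (subset_leq_card (subsetIr _ _))) // cards1.
  rewrite leqn0 cards_eq0 -subset0; apply/subsetP => A; rewrite !inE.
  by case/andP => /andP[_ lA] /eqP EA; rewrite -EA lA in nlx.
apply/subset_leq_card/subsetP => A; rewrite !in_setD in_set1 => /andP[nA AL].
apply: (leaf_cycles_tperm (leqnn k) AL).
by apply: contraNN nA => xA; have [->] := mem_leaf_cycles AL xA.
Qed.

(** After the swap the cycle through [x] also contains the center, so the old leaf cycle is lost and
    no new one appears. *)
Lemma leaf_cycles_merge c x : c k = k -> leaf_cycle (porbit c x) ->
  #|leaf_cycles (tperm x k * c)%g| < #|leaf_cycles c|.
Proof.
move=> ck lx; have xk := leaf_cycle_lt lx; set c' := (_ * c)%g.
apply: (@leq_ltn_trans #|leaf_cycles c :\ porbit c x|); last first.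
  by rewrite [X in _ < X](cardsD1 (porbit c x)) leaf_cycles_porbit lx.
apply/subset_leq_card/subsetP => A AL; have xA : x \notin A.
  apply/negP => xA; have [EA /andP[/subsetP/(_ k)]] := mem_leaf_cycles AL xA.
  have := mem_porbit c' 1 x; rewrite expg1 {1}/c' permM tpermL ck EA => ->.
  by rewrite inE ltnn => /(_ isT).
rewrite in_setD1 (leaf_cycles_tperm (leqnn k) AL xA) andbT.
by apply: contraNneq xA => ->; apply: porbit_id.
Qed.

(** * The distance as a lower bound *)

Definition broom_dist c : nat := relaxed_dist N.+1 c + (#|leaf_cycles c|).*2.

Lemma home_from_top c : home_from N.+1 c.
Proof. by move=> w; rewrite leqNgt ltn_ord. Qed.

(** Read backwards, the swap joins a closed set of leaves to the center, which is the situation of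
    [relaxed_dist_merge]. *)
Lemma relaxed_dist_leaf_cycle c x : leaf_cycle (porbit (tperm x k * c)%g x) ->
  relaxed_dist N.+1 c = (relaxed_dist N.+1 (tperm x k * c)%g).+1.
Proof.
set c' := (_ * c)%g => lx.
have -> : c = (tperm x k * c')%g by rewrite /c' mulgA tperm2 mul1g.
apply: (relaxed_dist_merge (C := porbit c' x)) => //.
- exact: home_from_top.
- move=> w wx; have /andP[/subsetP/(_ w wx)] := lx; rewrite inE => wk _; split=> //.
  by rewrite -[c']expg1 -eq_porbit_mem porbit_perm expg1 eq_porbit_mem.
- exact: porbit_id.
by apply/negP => kx; have /andP[/subsetP/(_ k kx)] := lx; rewrite inE ltnn.
Qed.

Lemma broom_edgeP (P : V -> V -> Prop) : (forall u v, P u v -> P v u) ->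
    (forall x, x < k -> P x k) ->
    (forall u v, k <= u -> v = u.+1 :> nat -> P u v) ->
  forall u v, broom_edge k u v -> P u v.
Proof.
move=> sym star pth u v /orP[]/orP[]/andP[].
- by move=> uk /eqP->; apply: star.
- by move=> vk /eqP->; apply: sym; apply: star.
- by move=> ku /eqP; apply: pth.
by move=> kv /eqP e; apply: sym; apply: pth.
Qed.

Lemma broom_dist_swap c u v : broom_edge k u v ->
  broom_dist (tperm u v * c)%g <= (broom_dist c).+1.
Proof.
move: u v; apply: broom_edgeP => [u v H|x xk|u v ku vu]; first by rewrite tpermC.
  have := leaf_cycles_star_swap c x; rewrite /broom_dist.
  case: (boolP (leaf_cycle _)) => [/relaxed_dist_leaf_cycle E|_] L.
    by rewrite E; move: L; rewrite add1n; set a := relaxed_dist _ _; lia.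
  have : relaxed_dist N.+1 (tperm x k * c)%g <= (relaxed_dist N.+1 c).+1.
    apply: relaxed_dist_tperm_le => //; first exact: home_from_top.
    by rewrite /clique_path_edge -val_eqE /=; lia.
  by rewrite -!muln2; lia.
have := leaf_cycles_path_swap c ku (_ : k <= v); rewrite vu => /(_ (leqW ku)) L.
have : relaxed_dist N.+1 (tperm u v * c)%g <= (relaxed_dist N.+1 c).+1.
  apply: relaxed_dist_tperm_le => //; first exact: home_from_top.
  by rewrite /clique_path_edge -val_eqE /=; lia.
by rewrite /broom_dist -!muln2; lia.
Qed.

Lemma porbit1 x : porbit (1%g : {perm V}) x = [set x].
Proof.
apply/setP => y; rewrite inE; apply/porbitP/eqP => [[i ->]|->].
  by rewrite expg1n perm1.
by exists 0; rewrite perm1.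
Qed.

Lemma broom_dist1 : broom_dist 1%g = 0.
Proof.
rewrite /broom_dist (@relaxed_dist_home 0) //=; last by move=> w _; rewrite perm1.
have -> : porbits (1%g : {perm V}) = [set [set x] | x in V].
  by apply: eq_imset => x; rewrite porbit1.
rewrite card_imset ?card_ord ?subnn; last exact: set1_inj.
suff -> : leaf_cycles 1%g = set0 by rewrite cards0.
apply/setP => A; rewrite !inE; apply/negP => /andP[/imsetP[x _ ->]].
by rewrite porbit1 /leaf_cycle cards1 andbF.
Qed.

Lemma home_fix c t : home c t -> c t = t.
Proof. by move=> /eqP E; rewrite -{1}E /position permKV. Qed.

Lemma all_home1 c : (forall t, home c t) -> c = 1%g.
Proof. by move=> H; apply/permP => w; rewrite perm1; apply: home_fix. Qed.

Lemma broom_dist_lower c s : sorting (broom_edge k) c s -> broom_dist c <= size s.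
Proof.
case; elim: s c => [|[u v] s IH] c /=; first by move=> _ /all_home1 ->; rewrite broom_dist1.
case/andP => e es H; apply: (@leq_trans (broom_dist (swap c (u, v))).+1).
  (* The swap is applied a second time, since what must be bounded is the decrease of the
     distance. *)
  by have := broom_dist_swap (swap c (u, v)) e; rewrite {1}/swap mulgA tperm2 mul1g.
by rewrite ltnS; apply: IH.
Qed.

(** * Swaps that lower the distance *)

Lemma home_from_tperm j c u v : u < j -> v < j ->
  home_from j c -> home_from j (tperm u v * c)%g.
Proof.
move=> uj vj H w jw; rewrite permM tpermD; first exact: H.
  by rewrite -val_eqE /=; lia.
by rewrite -val_eqE /=; lia.
Qed.

(** Once home, [t] is a fixed point and so no leaf cycle. Undoing the swap joins the closed set made
    of [t] to the center, so the relaxed distance was larger by 1. *)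
Lemma broom_dist_star_home c t : c k = t -> t < k ->
  broom_dist (tperm t k * c)%g < broom_dist c.
Proof.
move=> ck tk; set c' := (_ * c)%g.
have c't : c' t = t by rewrite /c' permM tpermL.
have := leaf_cycles_star_swap c t; rewrite -/c'.
have -> : porbit c' t = [set t].
  apply/setP => y; rewrite inE; apply/porbitP/eqP => [[i ->]|->].
    by rewrite permX; elim: i => //= i ->.
  by exists 0; rewrite perm1.
rewrite /leaf_cycle cards1 andbF add0n => L.
have : relaxed_dist N.+1 (tperm t k * c')%g = (relaxed_dist N.+1 c').+1.
  apply: (relaxed_dist_merge (C := [set t])) => //; rewrite ?inE //.
  - exact: home_from_top.
  - by move=> w; rewrite !inE => /eqP->; rewrite c't eqxx.
  by rewrite -val_eqE /=; lia.
rewrite {1}/c' mulgA tperm2 mul1g /broom_dist => ->.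
by set a := relaxed_dist _ _; lia.
Qed.

Lemma broom_dist_approach m c u v : k <= m -> home_from m.+1 c -> c u = m ->
    u < v -> k <= v -> v <= m -> clique_path_edge u v ->
    (u < k -> ~~ leaf_cycle (porbit (tperm u k * c)%g u)) ->
  broom_dist (tperm u v * c)%g < broom_dist c.
Proof.
move=> km H Eu uv kv vm e nl; rewrite /broom_dist.
have mN : m < N.+1 by [].
rewrite (@relaxed_dist_home m.+1 c) //.
rewrite (@relaxed_dist_home m.+1 (_ * c)%g) //; last first.
  by apply: home_from_tperm => //; lia.
rewrite (relaxed_dist_approach km H Eu uv kv vm e).
suff L : #|leaf_cycles (tperm u v * c)%g| <= #|leaf_cycles c|.
  by set a := relaxed_dist _ _; lia.
have [uk|ku] := ltnP u k; last exact: leaf_cycles_path_swap.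
have -> : v = k.
  by apply: val_inj; move: e; rewrite /clique_path_edge -val_eqE /=; lia.
by have := leaf_cycles_star_swap c u; rewrite (negbTE (nl uk)).
Qed.

(** The new leaf cycle, read from [x], is the chain: it starts with the token [c k] of the center,
    follows [c] through leaves, and returns to [x], on which [p] lies under [c]. *)
Lemma leaf_cycle_chain c x p : c x = p -> leaf_cycle (porbit (tperm x k * c)%g x) ->
  exists ts, centered_star_chain k c (rcons ts p).
Proof.
move=> Ex; set c' := (_ * c)%g => lx.
have lf i : iter i c' x < k.
  have /andP[/subsetP/(_ (iter i c' x))] := lx.
  by rewrite -permX mem_porbit inE => /(_ isT).
(* [j] counts the steps left until the cycle returns to [x]; before that, [c'] and [c] agree. *)
have aux j y : iter j c' y = x -> (forall i, i < j -> iter i c' y != x) ->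
    (forall i, iter i c' y < k) ->
    path (fun t t' => c t == t') y (rcons (traject c' (c' y) j) p) &&
    all (on_leaf k c) (rcons (traject c' (c' y) j) p).
  elim: j y => [|j IH] y /=.
    by move=> -> _ _; rewrite Ex eqxx /= andbT /on_leaf /position -Ex permK (lf 0).
  rewrite -iterS iterSr => Ej ne lt.
  have c'y : c' y = c y.
    rewrite /c' permM tpermD //; first by rewrite eq_sym (ne 0).
    by have := lt 0; rewrite -val_eqE /=; lia.
  have /andP[-> ->] :
    path (fun t t' => c t == t') (c' y) (rcons (traject c' (c' (c' y)) j) p) &&
    all (on_leaf k c) (rcons (traject c' (c' (c' y)) j) p).
    apply: IH => // [i ij|i]; first by rewrite -iterSr ne.
    by rewrite -iterSr lt.
  by rewrite c'y eqxx /= /on_leaf /position permK (lt 0).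
have [q Eq] : exists q, #|porbit c' x| = q.+1.
  by case/andP: lx => _; case: #|_| => // q _; exists q.
(* These are the iterates 1 to [q + 1] of [c'] at [x]; the last one is [x] itself. *)
exists (c' x :: traject c' (c' (c' x)) q); rewrite /=.
have ne i : i < q -> iter i c' (c' x) != x.
  move=> iq; rewrite -iterSr; have := uniq_traject_porbit c' x; rewrite Eq => U.
  have := nth_uniq x (_ : i.+1 < size (traject c' x q.+1)) (_ : 0 < _) U.
  by rewrite size_traject !nth_traject //= => ->.
have lt i : iter i c' (c' x) < k by rewrite -iterSr.
have Eq' : iter q c' (c' x) = x by rewrite -iterSr -Eq iter_porbit.
have /andP[-> ->] := aux q (c' x) Eq' ne lt; rewrite !andbT.
by rewrite /c' permM tpermL /position permK.
Qed.

(** * Tree paths *)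

(** A vertex [x] from the center on separates the smaller vertices from the larger ones. *)
Lemma broom_path_below x z (w : seq V) : k <= x -> z < x -> path (broom_edge k) z w ->
  x \notin w -> last z w < x.
Proof.
move=> kx; elim: w z => //= y w IH z zx /andP[e pw]; rewrite inE negb_or => /andP[xy xw].
apply: IH => //; move: e xy; rewrite /broom_edge /star_edge /path_edge -!val_eqE /=; lia.
Qed.

(** A step down from a path vertex [x] could reach [p] only by crossing [x] again, which a simple
    path excludes; from a leaf the only neighbor is the center. *)
Lemma tree_path_next x p y (w : seq V) : k <= p -> x <= p -> tree_path k x p (y :: w) ->
  [/\ x < y, k <= y, y <= p, clique_path_edge x y & tree_path k y p w].
Proof.
move=> kp xp /and3P[/= /andP[e pw] /eqP lp /andP[xyw U]].
have xnp : x != p by apply: contraNneq xyw => ->; rewrite -lp mem_last.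
have H : k <= x -> x < y.
  move=> kx; rewrite ltnNge leq_eqVlt negb_or; move: xyw; rewrite inE negb_or val_eqE eq_sym.
  case/andP=> -> xw /=; apply/negP => yx.
  by have := broom_path_below kx yx pw xw; rewrite lp; lia.
rewrite /tree_path /= pw lp eqxx U.
move: e xnp; rewrite /clique_path_edge /broom_edge /star_edge /path_edge -!val_eqE /= => e xnp.
by split; lia.
Qed.

Lemma all_pairmap_path (e : rel V) x (w : seq V) : path e x w ->
  all (fun a => e a.1 a.2) (pairmap pair x w).
Proof. by elim: w x => //= y w IH x /andP[-> /IH]. Qed.

Lemma broom_dist_move_home (w : seq V) m c x : k <= m -> home_from m.+1 c -> c x = m ->
    tree_path k x m w -> (x < k -> ~~ leaf_cycle (porbit (tperm x k * c)%g x)) ->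
  broom_dist (run c (pairmap pair x w)) + size w <= broom_dist c.
Proof.
move=> km; elim: w c x => [|y w IH] c x H Ex tp nl /=; first by rewrite addn0.
have xm := position_le H Ex.
have [xy ky ym e tp'] := tree_path_next km xm tp.
have := broom_dist_approach km H Ex xy ky ym e nl.
rewrite addnS; apply: leq_trans; rewrite ltnS.
apply: IH => //.
- by apply: home_from_tperm => //=; lia.
- by rewrite permM tpermR.
(* Only the first swap can start on a leaf, so the leaf cycle condition is vacuous from [y] on. *)
by rewrite ltnNge ky.
Qed.

Lemma tree_path_up d x p : k <= x -> p = x + d :> nat ->
  exists2 w : seq V, tree_path k x p w & all (fun y : V => x < y) w.
Proof.
elim: d x => [|d IH] x kx px.
  by exists [::] => //; rewrite /tree_path /= andbT -val_eqE /= px addn0.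
have xN : x.+1 < N.+1 by have := ltn_ord p; lia.
have [||w /and3P[pw lw uw] aw] := IH (Ordinal xN); rewrite /=; try lia.
have aw' : all (fun y : V => x < y) w by apply: sub_all aw => y /=; lia.
exists (Ordinal xN :: w); last by rewrite /= leqnn.
rewrite /= in uw; rewrite /tree_path /= pw lw uw !andbT /broom_edge /path_edge.
rewrite kx eqxx orbT /= inE negb_or.
apply/andP; split; first by rewrite -val_eqE /=; lia.
by apply/negP => /(allP aw'); rewrite ltnn.
Qed.

Lemma tree_path_exists x p : k <= p -> x <= p -> exists w : seq V, tree_path k x p w.
Proof.
move=> kp xp; have [kx|xk] := leqP k x.
  by have [|w] := @tree_path_up (p - x) x p kx; [lia|exists w].
have [|w /and3P[pw lw uw] aw] := @tree_path_up (p - k) k p (leqnn k); first lia.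
rewrite /= in uw; exists (k :: w).
rewrite /tree_path /= pw lw uw !andbT /broom_edge /star_edge xk eqxx /=.
rewrite inE negb_or; apply/andP; split; first by rewrite -val_eqE /=; lia.
by apply/negP => /(allP aw); lia.
Qed.

(** * Chains and rounds of Step 1 *)

Lemma fpath_pred c z (s : seq V) t : path (fun t t' => c t == t') z s -> t \in s ->
  exists2 v, v \in z :: s & c v = t.
Proof.
elim: s z => // v s IH z /= /andP[/eqP cz pv]; rewrite inE => /orP[/eqP->|ts].
  by exists z; rewrite ?mem_head.
by have [u uv E] := IH v pv ts; exists u => //; rewrite inE uv orbT.
Qed.

(** By injectivity of [c], an orbit walk can only close up at its starting point. *)
Lemma uniq_fpath c y (s : seq V) :
  path (fun t t' => c t == t') y s -> y \notin s -> uniq (y :: s).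
Proof.
elim: s y => // z s IH y /= /andP[/eqP cy ps]; rewrite inE negb_or => /andP[yz ys].
rewrite yz ys /=; apply: IH => //; apply/negP => /(fpath_pred ps)[v vs].
rewrite -cy => /perm_inj E; move: vs; rewrite E inE.
by rewrite (negbTE yz) (negbTE ys).
Qed.

(** Each swap sends the token on the center home and brings the next token of the chain to the
    center, so [broom_dist_star_home] applies at every step. [belast] leaves out the final token,
    which stops on the center. *)
Lemma run_chain ts c t1 : c k = t1 -> path (fun t t' => c t == t') t1 ts ->
    uniq (t1 :: ts) -> all (fun t : V => t < k) (belast t1 ts) ->
  let c' := run c [seq (k, t) | t <- belast t1 ts] in
  [/\ broom_dist c' + size ts <= broom_dist c, c' k = last t1 ts &
      forall w, k < w -> c' w = c w].
Proof.
elim: ts c t1 => [|t2 ts IH] c t1 ck /=; first by rewrite addn0.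
case/andP=> /eqP ct1 pt /andP[t1n U] /andP[t1k lt].
pose c1 := swap c (k, t1).
have c1E w : w != k -> w != t1 -> c1 w = c w.
  by move=> wk wt; rewrite /c1 /swap permM tpermD // eq_sym.
have c1k : c1 k = t2 by rewrite /c1 /swap permM tpermL.
(* The remaining links are read at leaves other than [t1], which the first swap does not touch. *)
have pt' : path (fun t t' => c1 t == t') t2 ts.
  move: pt lt t1n; clear -c1E; elim: ts t2 => //= t3 ts IH t2 /andP[ct2 pt] /andP[t2k lt].
  rewrite inE negb_or => /andP[t12 t1n]; rewrite IH // andbT c1E //.
    by rewrite -val_eqE /=; lia.
  by rewrite eq_sym.
have [D -> E] := IH c1 t2 c1k pt' U lt; split=> //.
  have := broom_dist_star_home ck t1k; rewrite tpermC.
  by rewrite addnS; apply: leq_trans; rewrite ltnS.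
move=> w kw; rewrite E // c1E // -val_eqE /=; lia.
Qed.

Lemma pmax_home_from c p : is_pmax k c p -> home_from p.+1 c.
Proof.
case=> kp _ H w pw; apply: home_fix; apply: contraLR pw => nh; rewrite -leqNgt.
have [kw|wk] := leqP k w; first exact: H.
by rewrite ltnW // (leq_trans wk kp).
Qed.

(** The destination of each token but the last is the position of its successor, which is a leaf. *)
Lemma chain_star_tokens c t1 ts : path (fun t t' => c t == t') t1 ts ->
  all (on_leaf k c) ts -> all (fun t : V => t < k) (belast t1 ts).
Proof.
elim: ts t1 => //= t2 ts IH t1 /andP[/eqP<- pt] /andP[l2 /(IH _ pt)->].
by move: l2; rewrite /on_leaf /position permK andbT.
Qed.

Lemma run_centered_chain c ts p : k <= p -> home_from p.+1 c ->
    centered_star_chain k c (rcons ts p) ->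
  let c' := run c [seq (k, t) | t <- ts] in
  [/\ broom_dist c' + size ts <= broom_dist c, c' k = p,
      home_from p.+1 c' & all (fun t : V => t < k) ts].
Proof.
move=> kp H; case E : (rcons ts p) => [|t1 rest] //= /and3P[/eqP pt1 al pa].
have ck : c k = t1 by rewrite -pt1 /position permKV.
have /rcons_inj[Ets Ep] : rcons ts p = rcons (belast t1 rest) (last t1 rest).
  by rewrite E lastI.
have lt := chain_star_tokens pa al.
have t1n : t1 \notin rest.
  by apply/negP => /(allP al); rewrite /on_leaf pt1 ltnn.
have [] := run_chain ck pa (uniq_fpath pa t1n) lt.
rewrite -Ets -Ep => D c'k fx; split=> //; last by rewrite Ets.
  by rewrite Ets size_belast -Ets.
by move=> v pv; rewrite fx ?H //; lia.
Qed.

Lemma broom_edge_star (t : V) : t < k -> broom_edge k k t.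
Proof. by move=> tk; rewrite /broom_edge /star_edge tk eqxx orbT. Qed.

Lemma step1_round_dist c s : step1_round k c s ->
  [/\ broom_dist (run c s) + size s <= broom_dist c,
      all (fun e => broom_edge k e.1 e.2) s & 0 < size s].
Proof.
case=> [p ts {}s pm lp|p {}s pm nc].
  move=> ch [w]; have kp : k <= p by case: pm.
  have [] := run_centered_chain kp (pmax_home_from pm) ch.
  set c' := run c _ => D c'k H' lt.
  have -> : position c' p = k by rewrite -c'k /position permK.
  move=> tp ->; rewrite /run foldl_cat -/(run c _) -/c' -/(run c' _).
  have D' : broom_dist (run c' (pairmap pair k w)) + size w <= broom_dist c'.
    by apply: (broom_dist_move_home kp H' c'k tp); rewrite ltnn.
  split.
  - by rewrite size_cat size_map size_pairmap; lia.
  - rewrite all_cat all_pairmap_path ?andbT; last by case/and3P: tp.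
    rewrite all_map; apply: sub_all lt => t /=; exact: broom_edge_star.
  (* With [ts] empty, [p] itself would be on the center, but it is on a leaf. *)
  rewrite size_cat size_map; case: (ts) ch => //= /andP[/eqP pk _].
  by move: lp; rewrite /on_leaf pk ltnn.
case=> w tp ->; have kp : k <= p by case: pm.
have Ex : c (position c p) = p by rewrite /position permKV.
split.
- rewrite size_pairmap; apply: (broom_dist_move_home kp (pmax_home_from pm) Ex tp).
  (* A leaf cycle created by the first swap would give [p] a centered star chain, contrary to the
     choice of this round. *)
  move=> xk; apply/negP => /(leaf_cycle_chain Ex) ch; exact: nc.
- by apply: all_pairmap_path; case/and3P: tp.
rewrite size_pairmap; case: w tp => // /and3P[_ /= h _].
by case: pm; rewrite /home h.
Qed.

(** * Step 2 and optimality *)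

(** Some star swap always lowers the distance. If the center holds a leaf token, send it home.
    Otherwise the center is home, and swapping it with a vertex of a leaf cycle destroys that cycle:
    the relaxed distance grows by 1 while the cycle term drops by 2. *)
Lemma star_sort c : home_from k.+1 c ->
  exists2 s, sorting (star_edge k) c s & size s <= broom_dist c.
Proof.
have [d] := ubnP (broom_dist c); elim: d c => // d IH c; rewrite ltnS => cd H.
have [->|c1] := eqVneq c 1%g.
  by exists [::] => //; split=> // t; rewrite /home /position /run /= invg1 perm1.
suff [x xk D] : exists2 x : V, x < k & broom_dist (tperm x k * c)%g < broom_dist c.
  have [||s [es hs] ss] := IH (tperm x k * c)%g; first by lia.
    by apply: home_from_tperm => //; lia.
  exists ((x, k) :: s); last by rewrite /=; lia.
  by split=> //=; rewrite es andbT /star_edge xk eqxx.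
have [ck|ck] := eqVneq (c k) k; last first.
  have ckk : c k < k.
    rewrite ltnNge leq_eqVlt negb_or val_eqE eq_sym ck /=; apply/negP => kc.
    by move: (H _ kc) => /perm_inj E; rewrite E eqxx in ck.
  by exists (c k) => //; apply: broom_dist_star_home.
have [x cx] : exists x, c x != x.
  apply/existsP; apply: contraNT c1 => /existsPn h; apply/eqP/permP => x.
  by rewrite perm1; apply/eqP; rewrite -[_ == _]negbK h.
have ltk w : w < k -> c w < k.
  move=> wk; rewrite ltnNge leq_eqVlt negb_or val_eqE; apply/andP; split.
    by apply/eqP => E; move: wk; rewrite -(perm_inj (etrans ck E)) ltnn.
  by apply/negP => kc; move: (H _ kc) => /perm_inj E; rewrite E in kc; lia.
have xk : x < k.
  rewrite ltnNge leq_eqVlt negb_or val_eqE; apply/andP; split.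
    by apply: contraNneq cx => <-; rewrite ck.
  by apply: contraNN cx => /H ->.
have lx : leaf_cycle (porbit c x).
  apply/andP; split.
    apply/subsetP => w /porbitP[i ->]; rewrite inE permX.
    by elim: i => //= i; apply: ltk.
  apply/card_gt1P; exists x, (c x); split; rewrite ?porbit_id // 1?eq_sym //.
  by have := mem_porbit c 1 x; rewrite expg1.
exists x => //; have := leaf_cycles_merge ck lx.
have := @relaxed_dist_leaf_cycle (tperm x k * c)%g x.
rewrite mulgA tperm2 mul1g => /(_ lx).
by rewrite /broom_dist => ->; set a := relaxed_dist _ _; lia.
Qed.

Lemma star_sorting_broom c s : sorting (star_edge k) c s -> sorting (broom_edge k) c s.
Proof.
by case=> es hs; split=> //; apply: sub_all es => e; rewrite /broom_edge => ->.
Qed.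

Lemma star_home_from c :
  (forall q, path_token k q -> home c q) -> home_from k.+1 c.
Proof. by move=> H w kw; apply: home_fix; apply: H; apply: ltnW. Qed.

Lemma algorithm_output_dist c s : algorithm_output k c s ->
  sorting (broom_edge k) c s /\ size s <= broom_dist c.
Proof.
elim=> {c s} [c s s' /step1_round_dist[D es _] _ [[es' hs'] D']|c s H [srt opt]].
  split; last by rewrite size_cat; lia.
  by split; rewrite ?all_cat ?es // /run foldl_cat.
split; first exact: star_sorting_broom.
have [s' srt' D] := star_sort (star_home_from H).
exact: leq_trans (opt _ srt') D.
Qed.

Lemma step1_round_exists c :
  (exists2 q, path_token k q & ~~ home c q) -> exists s, step1_round k c s.
Proof.
case=> q0 kq0 nq0.
have [p /andP[kp np] pmaxp] := @arg_maxnP _ q0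
  (fun q => path_token k q && ~~ home c q) (fun q => q : nat)
  (introT andP (conj kq0 nq0)).
have pm : is_pmax k c p by split=> // q kq nq; apply: pmaxp; rewrite kq.
have moves c' : home_from p.+1 c' -> exists s, moves_home k c' p s.
  move=> H; have xp : position c' p <= p.
    by apply: (position_le H); rewrite /position permKV.
  have [w tw] := tree_path_exists kp xp.
  by exists (pairmap pair (position c' p) w), w.
(* Excluded middle decides which kind of round applies, as a chain is quantified over all
   sequences. *)
have [[lp [ts ch]]|nc] := classic
  (on_leaf k c p /\ exists ts, centered_star_chain k c (rcons ts p)).
  have [_ _ H' _] := run_centered_chain kp (pmax_home_from pm) ch.
  have [s ms] := moves _ H'; exists ([seq (k, t) | t <- ts] ++ s).
  exact: RoundChain ms.
by have [s ms] := moves _ (pmax_home_from pm); exists s; apply: RoundDirect ms.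
Qed.

Lemma step1_next_dist c c' : step1_next k c' c -> broom_dist c' < broom_dist c.
Proof. by case=> s /step1_round_dist[D _ s0] ->; lia. Qed.

Lemma step1_next_acc c : Acc (step1_next k) c.
Proof.
have [d] := ubnP (broom_dist c); elim: d c => [|d IH] c; first by rewrite ltn0.
rewrite ltnS => cd; constructor=> c' /step1_next_dist lt.
by apply: IH; apply: leq_trans lt cd.
Qed.

Lemma algorithm_output_exists c : exists s, algorithm_output k c s.
Proof.
have [d] := ubnP (broom_dist c); elim: d c => // d IH c; rewrite ltnS => cd.
have [/existsP[q /andP[kq nq]]|/existsPn H] :=
    boolP [exists q, path_token k q && ~~ home c q].
  have [|s rs] := @step1_round_exists c; first by exists q.
  have [|s' os'] := IH (run c s); first by have [D _ s0] := step1_round_dist rs; lia.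
  by exists (s ++ s'); apply: Step1.
have {}H q : path_token k q -> home c q.
  by move=> kq; have := H q; rewrite kq negbK.
have [s srt D] := star_sort (star_home_from H).
(* A star sorting sequence also sorts on the broom, so [broom_dist] bounds its length from below and
   [s] is shortest on the star. *)
exists s; apply: Step2 => //; split=> // s' /star_sorting_broom/broom_dist_lower.
exact: leq_trans.
Qed.

End BroomDistance.

Theorem theorem7p5 (n : nat) (k : 'I_n) (c : config n) :
  [/\ Acc (step1_next k) c,
      exists s, algorithm_output k c s &
      forall s, algorithm_output k c s -> min_sorting (broom_edge k) c s].
Proof.
(* With [n = 0] there is no center; a successor size is what [inord] needs. *)
case: n k c => [[] // | N] k c; split.
- exact: step1_next_acc.
- exact: algorithm_output_exists.
move=> s /algorithm_output_dist[srt D]; split=> // s' /broom_dist_lower.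
exact: leq_trans.
Qed.
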